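(* Let $k\le n$ and $s$ be positive integers, let $\lambda$ be a partition of $k$ with at most $s$ parts, and let $\alpha_1,\dots,\alpha_s\in\mathbb{Q}$ be distinct. Then $I_{n,\lambda,s}=\mathrm{gr}\,I(X_{n,\lambda,s})$ as ideals of $\mathbb{Q}[x_1,\dots,x_n]$. Hence there is an equality of rings $$R_{n,\lambda,s}=\frac{\mathbb{Q}[x_1,\dots,x_n]}{\mathrm{gr}\,I(X_{n,\lambda,s})}.$$
   Context: A partition $\lambda=(\lambda_1\ge\dots\ge\lambda_{\ell(\lambda)}>0)$ has length $\ell(\lambda)$; set $\lambda_i=0$ for $i>\ell(\lambda)$, and let $\lambda'_j=\#\{i:\lambda_i\ge j\}$ be the parts of the conjugate partition (with $\lambda'_j=0$ for large $j$). Let $\mathbf{x}_n=\{x_1,\dots,x_n\}$. For $S\subseteq\mathbf{x}_n$ and $d\ge1$, $e_d(S)$ is the sum of all squarefree monomials of degree $d$ in the variables in $S$ (so $e_d(S)=0$ if $d>|S|$). For $0\le m\le n$ let $p^n_m(\lambda)=\lambda'_n+\lambda'_{n-1}+\dots+\lambda'_{n-m+1}$. Define $$I_{n,\lambda,s}=\langle x_i^s : 1\le i\le n\rangle+\langle e_d(S): S\subseteq\mathbf{x}_n,\ d>|S|-p^n_{|S|}(\lambda)\rangle,\qquad R_{n,\lambda,s}=\mathbb{Q}[\mathbf{x}_n]/I_{n,\lambda,s}.$$ $X_{n,\lambda,s}$ is the set of points $p=(p_1,\dots,p_n)\in\mathbb{Q}^n$ such that every coordinate $p_i$ lies in $\{\alpha_1,\dots,\alpha_s\}$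 and, for each $1\le i\le s$, $\alpha_i$ appears at least $\lambda_i$ times among the coordinates of $p$. $I(X_{n,\lambda,s})$ is the ideal of polynomials in $\mathbb{Q}[\mathbf{x}_n]$ vanishing at all points of $X_{n,\lambda,s}$. For a nonzero polynomial $f$ of degree $d$, $\tau(f)$ is its homogeneous component of degree $d$, and $\mathrm{gr}\,I(X_{n,\lambda,s})=\langle\tau(f): f\in I(X_{n,\lambda,s}),\ f\neq0\rangle$. *)

(* Defs.v *)
From HB Require Import structures.
From mathcomp Require Import all_boot all_order all_algebra.
From mathcomp Require Import ring_quotient mpoly.
From mathcomp Require Import boolp classical_sets.

Set Implicit Arguments.
Unset Strict Implicit.
Unset Printing Implicit Defensive.

Import GRing.Theory.

Local Open Scope ring_scope.
Local Open Scope classical_set_scope.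
Local Open Scope quotient_scope.

(* Unlike [idealr] of [ring_quotient], an ideal is not required to be proper;
   its quotient ring is therefore only a [comPzRingType], possibly zero. *)
Definition ideal_closed (R : comNzRingType) (S : {pred R}) : Prop :=
  0 \in S /\ forall a, {in S &, forall u v, a * u + v \in S}.

Record ideal (R : comNzRingType) := Ideal {
  ideal_pred :> {pred R};
  ideal_closedP : ideal_closed ideal_pred }.

Section IdealQuotient.
Variables (R : comNzRingType) (I : ideal R).

Fact ideal_zmod_closed : zmod_closed (ideal_pred I).
Proof.
have [I0 IS] := ideal_closedP I.
by split=> // x y xI yI; rewrite -mulN1r addrC IS.
Qed.

HB.instance Definition _ :=
  GRing.isZmodClosed.Build R (ideal_pred I) ideal_zmod_closed.

Fact ideal_mulr a u : u \in ideal_pred I -> a * u \in ideal_pred I.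
Proof.
have [I0 IS] := ideal_closedP I.
by move=> uI; rewrite -[a * u]addr0 IS.
Qed.

Definition quot_ring : Type := Quotient.quot (ideal_pred I : zmodClosed R).

HB.instance Definition _ := EqQuotient.on quot_ring.
HB.instance Definition _ := GRing.Zmodule.on quot_ring.

Local Notation Q := (Quotient.quot (ideal_pred I : zmodClosed R)).

Definition quot_one : Q := \pi_Q 1.
Definition quot_mul := lift_op2 Q *%R.

Fact pi_quot_mul x y : quot_mul (\pi_Q x) (\pi_Q y) = \pi_Q (x * y).
Proof.
unlock quot_mul; apply/eqP; rewrite -Quotient.idealrBE.
set x' := repr (\pi_Q x); set y' := repr (\pi_Q y).
have xx' : x' - x \in ideal_pred I by rewrite Quotient.idealrBE reprK.
have yy' : y' - y \in ideal_pred I by rewrite Quotient.idealrBE reprK.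
have -> : x' * y' - x * y = x' * (y' - y) + y * (x' - x).
  by rewrite !mulrBr [y * x']mulrC [y * x]mulrC addrA subrK.
by rewrite rpredD // ideal_mulr.
Qed.

Fact quot_mulA : associative quot_mul.
Proof.
move=> x y z; rewrite -[x]reprK -[y]reprK -[z]reprK.
by rewrite !pi_quot_mul mulrA.
Qed.

Fact quot_mulC : commutative quot_mul.
Proof. by move=> x y; rewrite -[x]reprK -[y]reprK !pi_quot_mul mulrC. Qed.

Fact quot_mul1 : left_id quot_one quot_mul.
Proof. by move=> x; rewrite -[x]reprK pi_quot_mul mul1r. Qed.

Fact quot_mulDl : left_distributive quot_mul (+%R : Q -> Q -> Q).
Proof.
move=> x y z; rewrite -[x]reprK -[y]reprK -[z]reprK.
by rewrite !pi_quot_mul -!raddfD /= pi_quot_mul mulrDl.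
Qed.

HB.instance Definition _ := GRing.Zmodule_isComPzRing.Build quot_ring
  quot_mulA quot_mulC quot_mul1 quot_mulDl.

End IdealQuotient.

Definition quotient (R : comNzRingType) (I : ideal R) : comPzRingType :=
  quot_ring I.

Section IdealOperations.
Variable R : comNzRingType.

Definition gen_pred (G : set R) : {pred R} := [pred f | `[<
  exists2 r : seq (R * R), (forall x, x \in r -> G x.2)
                         & f = \sum_(x <- r) x.1 * x.2 >]].

Fact gen_closed (G : set R) : ideal_closed (gen_pred G).
Proof.
split=> [|a u v]; first by apply/asboolP; exists [::]; rewrite ?big_nil.
move=> /asboolP[r rG ->] /asboolP[t tG ->]; apply/asboolP.
exists ([seq (a * x.1, x.2) | x <- r] ++ t) => [x|].
  by rewrite mem_cat => /orP[/mapP[y yr ->]|]; [apply: (rG y)|apply: tG].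
rewrite big_cat big_map mulr_sumr /=.
by under [in RHS]eq_bigr do rewrite -mulrA.
Qed.

Definition gen_ideal (G : set R) : ideal R := Ideal (gen_closed G).

Definition add_pred (I J : ideal R) : {pred R} := [pred f | `[<
  exists g h, [/\ g \in ideal_pred I, h \in ideal_pred J & f = g + h] >]].

Fact add_closed (I J : ideal R) : ideal_closed (add_pred I J).
Proof.
split=> [|a u v]; first by apply/asboolP; exists 0, 0; rewrite addr0 !rpred0.
move=> /asboolP[g [h [gI hJ ->]]] /asboolP[g' [h' [gI' hJ' ->]]].
apply/asboolP; exists (a * g + g'), (a * h + h').
by rewrite mulrDr addrACA !rpredD ?ideal_mulr.
Qed.

Definition add_ideal (I J : ideal R) : ideal R := Ideal (add_closed I J).

End IdealOperations.

Definition is_partition (k : nat) (lam : seq nat) : Prop :=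
  [/\ sorted geq lam, all (fun a => 0 < a)%N lam & sumn lam = k].

(* Number of parts that are at least j; only meant for j >= 1. *)
Definition conj_part (lam : seq nat) (j : nat) : nat :=
  count (fun a => j <= a)%N lam.

Definition p_stat (n m : nat) (lam : seq nat) : nat :=
  (\sum_(i < m) conj_part lam (n - i))%N.

Section Ideals.
Variable n : nat.
Local Notation P := {mpoly rat[n]}.

Definition elem_sym (S : {set 'I_n}) (d : nat) : P :=
  \sum_(A : {set 'I_n} | (A \subset S) && (#|A| == d)) \prod_(i in A) 'X_i.

(* The inequality d > |S| - p is stated without truncated subtraction. *)
Definition I_ideal (lam : seq nat) (s : nat) : ideal P := add_ideal
  (gen_ideal [set f | exists i : 'I_n, f = 'X_i ^+ s])
  (gen_ideal [set f | exists (S : {set 'I_n}) (d : nat),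
     [/\ (1 <= d)%N, (#|S| < d + p_stat n #|S| lam)%N & f = elem_sym S d]]).

Definition R_ring (lam : seq nat) (s : nat) : comPzRingType :=
  quotient (I_ideal lam s).

(* Indices are shifted: the i-th scalar, i < s, comes with the part
   [nth 0 lam i], which is 0 beyond the length of lam. *)
Definition X_points (lam : seq nat) (s : nat) (alpha : 'I_s -> rat) :
    set (n.-tuple rat) :=
  [set p | (forall j, exists i, tnth p j = alpha i) /\
           (forall i : 'I_s, (nth 0 lam i <= count_mem (alpha i) p)%N)].

Definition van_pred (X : set (n.-tuple rat)) : {pred P} :=
  [pred f : P | `[< forall p, X p -> f.@[tnth p] = 0 >]].

Fact van_closed (X : set (n.-tuple rat)) : ideal_closed (van_pred X).
Proof.
split=> [|a u v]; first by apply/asboolP => p _; rewrite meval0.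
move=> /asboolP u0 /asboolP v0; apply/asboolP => p Xp.
by rewrite mevalD mevalM u0 // v0 // mulr0 addr0.
Qed.

Definition vanishing_ideal (X : set (n.-tuple rat)) : ideal P :=
  Ideal (van_closed X).

(* [msize f] is the total degree plus one for nonzero f. *)
Definition top_comp (f : P) : P := pihomog mdeg (msize f).-1 f.

Definition gr_ideal (I : ideal P) : ideal P :=
  gen_ideal [set top_comp f | f in [set f | f \in ideal_pred I /\ f != 0]].

End Ideals.

Arguments X_points n lam {s} alpha.

(* Main.v *)
Require Import Defs.
From mathcomp Require Import all_boot all_order all_algebra.
From mathcomp Require Import mpoly.
From mathcomp Require Import zify ring.
From mathcomp Require Import boolp.
From mathcomp Require classical_sets.

Set Implicit Arguments.
Unset Strict Implicit.
Unset Printing Implicit Defensive.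

(** Write V for the vanishing ideal of the set X of points, and I for the ideal
[I_ideal n lam s]. The argument compares I with gr V by counting.

The inclusion of I in gr V says that each generator of I, homogeneous of some
degree d, agrees on X with a polynomial of degree less than d. For the power of
a variable this follows by expanding the product of the [X_i - alpha_r]. For
[e_d(S)] it is a form of Vieta's formulas: at a point of X, the value [alpha_r]
is taken at least [lam_r - (n - |S|)] times on S, so the polynomial
[prod_(i in S) ('X + x_i)], whose coefficients are the [e_d(S)], is divisible by
[F = prod_r ('X + alpha_r) ^+ (lam_r - (n - |S|))], which does not depend on the
point. Reducing it modulo F expresses the elementary symmetric polynomials of
high degree by those of low degree ([elem_sym_drops]).

For the converse inclusion one finds a list B of monomials that spans the
quotient by I and has no more elements than X has points. This is an
induction on the set U of variables in use ([rel_ideal_span]). All the ideals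
live in the same polynomial ring: the variables outside U are simply put in the
ideal. Let x be a variable in U, and let r be the (i+1)-st row of lam, the rows
being listed by decreasing length. Multiplication by [x ^+ i] sends the ideal
for [U :\ x], with row r shortened by one box, into the ideal for U modulo
multiples of [x ^+ i.+1] ([rel_ideal_dec_row]). So the monomials [x ^+ i * m],
where i < s and m runs over the list for row r shortened, span the quotient.
The same recursion holds for the words in which each letter r occurs at least
[lam_r] times, according to their first letter; those words index points of X.

Finally B spans the functions on these points, because I is homogeneous and
contained in gr V. Since B is no longer than the list of points, its elements
are linearly independent on them ([indep_of_span]). If f in V has top component
t, then t is congruent modulo I to a combination q of elements of B of the same
degree. Modulo V, all of f - q is congruent to a combination of elements of B of
lower degree, and f vanishes on X; by independence q = 0, so that t lies in I
([gr_sub_gen_ideal]). *)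

Import GRing.Theory.

(** * Ideals given by generators *)

Section Ideals.
Local Open Scope ring_scope.
Variable R : comNzRingType.
Implicit Types (G : classical_sets.set R) (I J : ideal R) (f g h : R).

Lemma idealD I f g : f \in I -> g \in I -> f + g \in I.
Proof. by move=> fI gI; rewrite -[f]mul1r; apply: (ideal_closedP I).2. Qed.

Lemma ideal0 I : 0 \in I.
Proof. exact: (ideal_closedP I).1. Qed.

Lemma idealMl I f g : g \in I -> f * g \in I.
Proof. exact: ideal_mulr. Qed.

Lemma idealN I f : f \in I -> - f \in I.
Proof. by move=> fI; rewrite -mulN1r idealMl. Qed.

Lemma idealB I f g : f \in I -> g \in I -> f - g \in I.
Proof. by move=> fI gI; rewrite idealD ?idealN. Qed.

Lemma gen_ideal_gen G g : G g -> g \in gen_ideal G.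
Proof.
move=> Gg; apply/asboolP; exists [:: (1, g)]; last by rewrite big_seq1 mul1r.
by move=> x; rewrite inE => /eqP ->.
Qed.

Lemma gen_ideal_ind G (K : R -> Prop) :
  K 0 -> (forall a g h, G g -> K h -> K (a * g + h)) ->
  forall h, h \in gen_ideal G -> K h.
Proof.
move=> K0 KD h /asboolP[r rG ->]; elim: r rG => [|x r IHr] rG.
  by rewrite big_nil.
rewrite big_cons; apply: KD; first by apply: rG; rewrite mem_head.
by apply: IHr => y yr; apply: rG; rewrite inE yr orbT.
Qed.

Lemma gen_ideal_sub G I :
  (forall g, G g -> g \in I) -> forall h, h \in gen_ideal G -> h \in I.
Proof.
move=> GI; apply: gen_ideal_ind => [|a g h Gg hI]; first exact: ideal0.
by apply: idealD => //; apply/idealMl/GI.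
Qed.

Lemma add_ideal_l I J f : f \in I -> f \in add_ideal I J.
Proof. by move=> fI; apply/asboolP; exists f, 0; rewrite addr0 ideal0. Qed.

Lemma add_ideal_r I J f : f \in J -> f \in add_ideal I J.
Proof. by move=> fJ; apply/asboolP; exists 0, f; rewrite add0r ideal0. Qed.

(** The proofs of closure carried by ideals are irrelevant. *)
Lemma eq_ideal I J : (forall f, (f \in I) = (f \in J)) -> I = J.
Proof.
case: I J => [I cI] [J cJ] IJ.
have eIJ : I = J by apply: funext => f; exact: IJ.
by case: _ / eIJ in cJ IJ *; rewrite (Prop_irrelevance cI cJ).
Qed.

End Ideals.

(** * Elementary symmetric polynomials of a set of variables *)

Section Subsets.
Local Open Scope ring_scope.

Lemma prod_add_subsets (R : comNzRingType) (I : finType) (S : {set I})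
    (y : R) (z : I -> R) :
  \prod_(i in S) (z i + y) =
  \sum_(A : {set I} | A \subset S) (\prod_(i in A) z i) * y ^+ (#|S| - #|A|).
Proof.
transitivity (\prod_i ((if i \in S then z i else 0)
                       + (if i \in S then y else 1))).
  rewrite big_mkcond /=; apply: eq_bigr => i _.
  by case: ifP => //; rewrite add0r.
rewrite bigA_distr (bigID (fun A : {set I} => A \subset S)) /=.
rewrite [X in _ + X]big1 ?addr0 => [|A /subsetPn[i iA iS]]; last first.
  by rewrite (bigD1 i) //= iA (negPf iS) mul0r.
apply: eq_bigr => A AS.
rewrite (bigID (mem A)) /=; congr (_ * _).
  by apply: eq_bigr => i iA; rewrite iA (subsetP AS).
have -> : (#|S| - #|A|)%N = #|S :\: A| by rewrite cardsD (setIidPr AS).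
rewrite -prodr_const big_mkcond [RHS]big_mkcond /=.
apply: eq_bigr => i _; rewrite !inE.
by case: (i \in A); case: (i \in S).
Qed.

Lemma elem_sym0 n (S : {set 'I_n}) : elem_sym S 0 = 1.
Proof.
rewrite /elem_sym (big_pred1 set0) ?big_set0 // => A.
by rewrite cards_eq0 andb_idl // => /eqP ->; apply: sub0set.
Qed.

Lemma elem_sym_gt n (S : {set 'I_n}) d : (#|S| < d)%N -> elem_sym S d = 0.
Proof.
move=> Sd; apply: big_pred0 => A; apply: negbTE; apply/andP => -[AS /eqP Ad].
by have := subset_leq_card AS; rewrite Ad leqNgt Sd.
Qed.

Lemma elem_symU1 n (S : {set 'I_n}) x d : x \notin S ->
  elem_sym (x |: S) d.+1 = elem_sym S d.+1 + 'X_x * elem_sym S d.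
Proof.
move=> xS; rewrite {1}/elem_sym (bigID (fun A : {set _} => x \in A)) /= addrC.
congr (_ + _).
  apply: eq_bigl => A; rewrite andbAC; congr (_ && _).
  by rewrite -subsetD1 setU1K.
rewrite (reindex_onto (fun A : {set _} => x |: A) (fun A => A :\ x)) /=; last first.
  by move=> A /andP[_ xA]; rewrite setD1K.
rewrite mulr_sumr; apply: eq_big => [A|A].
  rewrite setU11 andbT; case: (boolP (x \in A)) => xA.
    rewrite [RHS]andbC [LHS]andbC.
    have -> : (A \subset S) = false.
      by apply: contraNF xS => /subsetP/(_ _ xA).
    rewrite andbF; case: eqP => // /setP/(_ x).
    by rewrite !inE eqxx xA.
  rewrite setU1K // eqxx andbT cardsU1 xA eqSS; congr (_ && _).
  by rewrite subUset sub1set setU11 -{2}(setU1K xS) subsetD1 xA andbT.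
move=> /andP[_ /eqP AE]; rewrite big_setU1 // -AE.
by rewrite !inE eqxx.
Qed.

End Subsets.

(** * Monomials spanning the quotient *)

Section Spanning.
Local Open Scope ring_scope.
Variables n s : nat.
Local Notation P := {mpoly rat[n]}.
Implicit Types (U S : {set 'I_n}) (mu : 'I_s -> nat) (I : ideal P).

(** With [mu] the row lengths, the number of boxes beyond column [a]. Unlike
[p_stat], it is not indexed by the number of columns, and [mu] need be neither
decreasing nor bounded by the number of variables. *)
Definition excess mu (a : nat) : nat := (\sum_r (mu r - a))%N.

(** Generators of the analogue of [I_ideal] for the variables indexed by [U]
and the rows [mu]. The variables outside [U] are among the generators, so the
quotient involves the variables of [U] only. The degree [d = 0] is allowed: the
ideal is the whole ring when [mu] has more than [#|U|] boxes. *)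
Definition rel_gens U mu : classical_sets.set P := fun f =>
  [\/ exists i, f = 'X_i ^+ s,
      exists2 i, i \notin U & f = 'X_i
    | exists S d, [/\ S \subset U, (#|S| < d + excess mu (#|U| - #|S|))%N
                    & f = elem_sym S d]].

Definition rel_ideal U mu : ideal P := gen_ideal (rel_gens U mu).

(** The rows [mu] with one box removed from row [r], if that row is nonempty. *)
Definition dec_row mu (r r' : 'I_s) : nat := (mu r' - (r' == r))%N.

Lemma excess_dec_row mu r a :
  excess mu a = ((a < mu r) + excess (dec_row mu r) a)%N.
Proof.
rewrite /excess (bigD1 r) // [X in (_ + X)%N](bigD1 r) //= addnA.
congr (_ + _)%N.
  by rewrite /dec_row eqxx; case: ltnP; lia.
by apply: eq_bigr => r' /negPf r'r; rewrite /dec_row r'r subn0.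
Qed.

Lemma excessS mu a : excess mu a = (#|[set r | a < mu r]| + excess mu a.+1)%N.
Proof.
rewrite /excess -sum1_card [X in (X + _)%N]big_mkcond -big_split /=.
apply: eq_bigr => r _.
by rewrite inE; case: ltnP; lia.
Qed.

Lemma rel_idealX U mu i : 'X_i ^+ s \in rel_ideal U mu.
Proof. by apply: gen_ideal_gen; constructor 1; exists i. Qed.

Lemma rel_ideal_out U mu i : i \notin U -> 'X_i \in rel_ideal U mu.
Proof. by move=> iU; apply: gen_ideal_gen; constructor 2; exists i. Qed.

Lemma rel_ideal_elem U mu S d : S \subset U ->
  (#|S| < d + excess mu (#|U| - #|S|))%N -> elem_sym S d \in rel_ideal U mu.
Proof. by move=> SU Sd; apply: gen_ideal_gen; constructor 3; exists S, d. Qed.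

(** Modulo the elements [e_e(S u {x})], multiplying by [- x] raises the degree
of an elementary symmetric polynomial of [S] by one. *)
Lemma exp_elem_sym_ideal I S x j d : x \notin S ->
  (forall e, (d < e)%N -> elem_sym (x |: S) e \in I) ->
  elem_sym S (d + j) \in I -> 'X_x ^+ j * elem_sym S d \in I.
Proof.
move=> xS; elim: j d => [|j IHj] d eI; first by rewrite addn0 mul1r.
rewrite addnS -addSn => edI; rewrite exprSr -mulrA.
have -> : 'X_x * elem_sym S d = elem_sym (x |: S) d.+1 - elem_sym S d.+1.
  by rewrite elem_symU1 // addrAC subrr add0r.
rewrite mulrBr; apply: idealB; first exact/idealMl/eI.
by apply: IHj => // e de; apply: eI; apply: ltnW.
Qed.

(** The recursive step: multiplication by ['X_x ^+ i] maps the ideal of the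
shortened rows [dec_row mu r] on [U :\ x] into that of [mu] on [U], modulo
['X_x ^+ i.+1]. The hypothesis on [i] says that every column that row [r] does
not reach has length at most [i]; it holds when [r] is preceded by [i] rows in
an enumeration by decreasing length. *)
Lemma rel_ideal_dec_row U mu x r i h : x \in U ->
  (forall a, (mu r <= a)%N -> (#|[set r' | a < mu r']| <= i)%N) ->
  h \in rel_ideal (U :\ x) (dec_row mu r) ->
  exists u, 'X_x ^+ i * h - 'X_x ^+ i.+1 * u \in rel_ideal U mu.
Proof.
move=> xU mu_i; move: h; apply: gen_ideal_ind => [|a g h Gg [uh uhI]].
  by exists 0; rewrite !mulr0 subr0 ideal0.
suff [ug ugI] : exists u, 'X_x ^+ i * g - 'X_x ^+ i.+1 * u \in rel_ideal U mu.
  exists (a * ug + uh).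
  have -> : 'X_x ^+ i * (a * g + h) - 'X_x ^+ i.+1 * (a * ug + uh)
          = a * ('X_x ^+ i * g - 'X_x ^+ i.+1 * ug)
            + ('X_x ^+ i * h - 'X_x ^+ i.+1 * uh).
    by move: ('X_x ^+ i) ('X_x ^+ i.+1) => X Y; ring.
  by apply: idealD => //; apply: idealMl.
case: Gg => [[j ->]|[j jU ->]|[S [d [SU Sd ->]]]].
- by exists 0; rewrite mulr0 subr0; apply/idealMl/rel_idealX.
- case: (eqVneq j x) => [->|jx].
    by exists 1; rewrite mulr1 exprSr subrr ideal0.
  exists 0; rewrite mulr0 subr0; apply/idealMl/rel_ideal_out.
  by move: jU; rewrite !inE jx.
have := SU; rewrite subsetD1 => /andP[SU' xS].
have Sx : (#|x |: S| = #|S|.+1)%N by rewrite cardsU1 xS.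
have Ux : (#|U| = #|U :\ x|.+1)%N by rewrite (cardsD1 x) xU.
have SxU : x |: S \subset U by rewrite subUset sub1set xU.
have leSU := subset_leq_card SU.
move: Sd; set a' := (#|U :\ x| - #|S|)%N => Sd.
have ex_dec := excess_dec_row mu r a'.
(* If row [r] has no box beyond column [a'], then ['X_x ^+ i * elem_sym S d] is
   itself in the ideal: it is, up to sign, [elem_sym S (d + i)], and replacing
   [x |: S] by [S] leaves out one column, which has at most [i] boxes. *)
have [mu_a|a_mu] := leqP (mu r) a'.
  exists 0; rewrite mulr0 subr0.
  move: ex_dec; rewrite ltnNge mu_a add0n => ex_dec.
  apply: exp_elem_sym_ideal => // [e de|].
    apply: rel_ideal_elem => //; rewrite Sx Ux subSS -/a'; lia.
  apply: rel_ideal_elem => //; rewrite Ux subSn // -/a'.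
  have := mu_i _ mu_a; have := excessS mu a'; lia.
(* Otherwise [mu] has one more box than [dec_row mu r] beyond column [a'], which
   makes up for the additional element of [x |: S]. *)
move: ex_dec; rewrite a_mu => ex_dec.
have eI : elem_sym (x |: S) d \in rel_ideal U mu.
  by apply: rel_ideal_elem => //; rewrite Sx Ux subSS -/a'; lia.
case: d Sd eI => [|d] Sd eI.
  exists 0; rewrite mulr0 subr0 elem_sym0.
  by apply: idealMl; rewrite elem_sym0 in eI.
exists (- elem_sym S d).
rewrite (_ : _ - _ = 'X_x ^+ i * elem_sym (x |: S) d.+1) ?idealMl //.
by rewrite elem_symU1 // mulrN opprK mulrDr exprSr mulrA.
Qed.

(** [f] is congruent modulo [I] to a combination of the monomials in [B]. *)
Definition in_span (B : seq 'X_{1..n}) I (f : P) : Prop :=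
  exists2 q : P, {subset msupp q <= B} & f - q \in I.

Lemma in_span_sub B I I' f : (forall h, h \in I -> h \in I') ->
  in_span B I f -> in_span B I' f.
Proof. by move=> II' [q qB fq]; exists q => //; apply: II'. Qed.

Lemma in_span_ideal B I f : f \in I -> in_span B I f.
Proof. by move=> fI; exists 0; rewrite ?subr0 // => m; rewrite msupp0. Qed.

Lemma in_span_set0 mu f : in_span [:: 0%MM] (rel_ideal set0 mu) f.
Proof.
suff [c fc] : exists c, f - c%:MP \in rel_ideal set0 mu.
  exists c%:MP => // m; rewrite msuppC; case: ifP => //.
elim/mpolyind: f => [|c m p _ _ [c' pc']].
  by exists 0; rewrite subr0 ideal0.
have [->|/eqP] := eqVneq m 0%MM.
  exists (c + c'); rewrite mpolyX0 alg_mpolyC mpolyCD.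
  by rewrite opprD addrACA subrr add0r.
move/eqP; rewrite -mdeg_eq0 => m0.
have [i mi] : exists i, (m i != 0)%N.
  apply/existsP; apply: contraNT m0; rewrite negb_exists => /forallP m0.
  rewrite mdegE big1 // => i _; apply/eqP.
  by have := m0 i; rewrite negbK.
exists c'; rewrite -addrA; apply: idealD => //.
have -> : m = (U_(i) + (m - U_(i)))%MM.
  by rewrite addmC submK // lep1mP.
rewrite mpolyXD mulrC scalerAl.
by apply: idealMl; apply: rel_ideal_out; rewrite inE.
Qed.

(** The quotient is spanned by at most as many monomials as there are words of
length [#|U|] in which each letter [r] occurs at least [mu r] times. *)
Lemma rel_ideal_span U mu : exists B (W : seq (seq 'I_s)),
  [/\ uniq W,
      forall w, w \in W -> size w = #|U| /\ forall r, (mu r <= count_mem r w)%N,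
      (size B <= size W)%N
    & forall f, in_span B (rel_ideal U mu) f].
Proof.
move: {2}#|U| (erefl #|U|) => u; elim: u U mu => [|u IHu] U mu cU.
  move/eqP: (cU); rewrite cards_eq0 => /eqP U0; rewrite U0.
  have [/forallP mu0|] := boolP [forall r, mu r == 0%N].
    exists [:: 0%MM], [:: [::]]; split => // [w|f]; last exact: in_span_set0.
    by rewrite inE => /eqP ->; split=> [|r]; rewrite ?cards0 ?(eqP (mu0 r)).
  rewrite negb_forall => /existsP[r mur].
  exists [::], [::]; split => // f; apply: in_span_ideal.
  rewrite -[f]mulr1; apply: idealMl.
  rewrite -(elem_sym0 (set0 : {set 'I_n})); apply: rel_ideal_elem => //.
  rewrite cards0 add0n /excess (bigD1 r) //=; lia.
have [x xU] : exists x, x \in U by apply/card_gt0P; rewrite cU.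
pose lem r r' := (mu r' <= mu r)%N.
pose rows := sort lem (enum 'I_s).
have lem_trans : transitive lem by move=> r1 r2 r3 h1 h2; apply: leq_trans h2 h1.
have rows_sorted : sorted lem rows by apply: sort_sorted => r r'; apply: leq_total.
have rows_uniq : uniq rows by rewrite sort_uniq enum_uniq.
have mem_rows r : r \in rows by rewrite mem_sort mem_enum.
have size_rows : size rows = s by rewrite size_sort size_enum_ord.
suff step rs pre : rows = pre ++ rs -> exists B (W : seq (seq 'I_s)),
  [/\ uniq W,
      forall w, w \in W -> [/\ size w = #|U|,
         forall r, (mu r <= count_mem r w)%N & exists2 r, r \in rs & ohead w = Some r],
      (size B <= size W)%N
    & forall f, in_span B (rel_ideal U mu) ('X_x ^+ size pre * f)].
  have [B [W [uW gW BW sB]]] := step rows [::] erefl.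
  exists B, W; split=> // [w /gW[]|f] //.
  by rewrite -[f]mul1r; apply: sB.
(* [pre] lists the rows already treated: the rows of [rs] account for the
   multiples of ['X_x ^+ size pre]. *)
elim: rs pre => [|r rs IHrs] pre def_rows.
  exists [::], [::]; split=> // f; apply: in_span_ideal.
  have -> : size pre = s by move: size_rows; rewrite def_rows cats0.
  by rewrite mulrC; apply/idealMl/rel_idealX.
have cUx : #|U :\ x| = u by move: cU; rewrite (cardsD1 x) xU => -[].
have [B1 [W1 [uW1 gW1 BW1 sB1]]] := IHu (U :\ x) (dec_row mu r) cUx.
have [|B2 [W2 [uW2 gW2 BW2 sB2]]] := IHrs (rcons pre r); first by rewrite cat_rcons.
exists ([seq (U_(x) *+ size pre + m)%MM | m <- B1] ++ B2).
exists ([seq r :: w | w <- W1] ++ W2); split.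
- rewrite cat_uniq map_inj_uniq ?uW1 ?uW2 ?andbT /=; last by move=> ? ? [].
  apply/hasPn => w /gW2[_ _ [r' r'rs wr']]; apply/mapP => -[w' _ ww'].
  move: wr'; rewrite ww' => -[rr']; move: rows_uniq.
  by rewrite def_rows cat_uniq /= rr' r'rs !andbF.
- move=> w; rewrite mem_cat => /orP[/mapP[w' /gW1[sw' cw'] ->]|/gW2].
    split; first by rewrite /= sw' cUx cU.
      move=> r'; have := cw' r'; rewrite /dec_row /= (eq_sym r r').
      by case: (r' == r) => /=; lia.
    by exists r; rewrite ?mem_head.
  move=> [sw cw [r' r'rs wr']]; split=> //.
  by exists r'; rewrite // inE r'rs orbT.
- by rewrite !size_cat !size_map leq_add.
move=> f; have [q1 q1B fq1] := sB1 f.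
have mu_pre a : (mu r <= a)%N -> (#|[set r' | a < mu r']| <= size pre)%N.
  move=> ra; apply: leq_trans (card_size pre); apply: subset_leq_card.
  apply/subsetP => r'; rewrite inE => ar'.
  have := mem_rows r'; rewrite def_rows mem_cat => /orP[//|r'rs].
  have : sorted lem (r :: rs).
    by move: rows_sorted; rewrite def_rows => /cat_sorted2[].
  move/(order_path_min lem_trans)/allP => rs_min.
  move: r'rs ar'; rewrite inE => /orP[/eqP ->|/rs_min]; rewrite /lem; lia.
have [u' u'I] := rel_ideal_dec_row xU mu_pre fq1.
have [q2 q2B uq2] := sB2 u'; rewrite size_rcons in uq2.
exists ('X_x ^+ size pre * q1 + q2) => [m /msuppD_le|].
  rewrite !mem_cat => /orP[|/q2B ->]; last by rewrite orbT.
  rewrite mpolyXn mulrC (perm_mem (msuppMX _ _)) => /mapP[m' /q1B m'B ->].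
  by rewrite (map_f (fun m => _ + m)%MM).
rewrite (_ : _ - _ = ('X_x ^+ size pre * (f - q1) - 'X_x ^+ (size pre).+1 * u')
   + ('X_x ^+ (size pre).+1 * u' - q2)); first exact: idealD.
by rewrite mulrBr opprD addrA subrKA.
Qed.

End Spanning.

(** * Leading forms modulo an ideal *)

Section Homogeneous.
Local Open Scope ring_scope.
Variable n : nat.
Local Notation P := {mpoly rat[n]}.
Local Notation homc := (pihomog mdeg).
Implicit Types (f g h r : P) (I V : ideal P).

Lemma msize_leP f d : reflect {in msupp f, forall m, mdeg m < d}%N (msize f <= d)%N.
Proof.
apply: (iffP idP) => [fd m mf|lt_d].
  by apply: leq_trans fd; apply: msize_mdeg_lt.
by rewrite msizeE big_tnth; apply/bigmax_leqP => i _; apply/lt_d/mem_tnth.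
Qed.

Lemma dhomog_msize_le d f : f \is d.-homog -> (msize f <= d.+1)%N.
Proof. by move/dhomogP => fd; apply/msize_leP => m /fd /= ->. Qed.

Lemma msizeM_le_add f g d e : (msize f <= d.+1)%N -> (msize g <= e)%N ->
  (msize (f * g) <= d + e)%N.
Proof.
move=> fd ge.
have [->|f0] := eqVneq f 0; first by rewrite mul0r msize0.
have [->|g0] := eqVneq g 0; first by rewrite mulr0 msize0.
by rewrite msizeM // -subn1 leq_subLR add1n -addSn leq_add.
Qed.

Lemma msizeD_le_max f g d : (msize f <= d)%N -> (msize g <= d)%N ->
  (msize (f + g) <= d)%N.
Proof. by move=> fd gd; apply: leq_trans (msizeD_le _ _) _; rewrite geq_max fd. Qed.

Lemma pihomog_gt d f : (msize f <= d)%N -> homc d f = 0.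
Proof.
move/msize_leP => fd; rewrite pihomogE big_seq_cond big_pred0 // => m.
by apply/negP => /andP[/fd md /eqP dE]; rewrite dE ltnn in md.
Qed.

Lemma msize_sub_pihomog d f : (msize f <= d.+1)%N -> (msize (f - homc d f) <= d)%N.
Proof.
move=> fd; rewrite {1}(pihomog_partitionE fd) big_ord_recr /= addrK.
apply: leq_trans (mmeasure_sum _ _ _ _) _; apply/bigmax_leqP => e _.
by apply: leq_trans (dhomog_msize_le (pihomogP _ _ _)) _; apply: ltn_ord.
Qed.

(** [h] is congruent modulo [V] to a polynomial of total degree less than
[d]. *)
Definition drops V d h : Prop := exists2 r, (msize r <= d)%N & h - r \in V.

Lemma drops0 V d : drops V d 0.
Proof. by exists 0; rewrite ?msize0 // subr0 ideal0. Qed.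

Lemma dropsD V d f g : drops V d f -> drops V d g -> drops V d (f + g).
Proof.
move=> [r rd fr] [t td gt]; exists (r + t); first exact: msizeD_le_max.
by rewrite opprD addrACA; apply: idealD.
Qed.

Lemma drops_sum V d (T : Type) (l : seq T) (F : T -> P) :
  (forall t, drops V d (F t)) -> drops V d (\sum_(t <- l) F t).
Proof.
move=> FV; elim: l => [|t l IHl]; first by rewrite big_nil; apply: drops0.
by rewrite big_cons; apply: dropsD.
Qed.

Lemma drops_homog_mul V d e a g : g \is e.-homog -> drops V e g ->
  drops V d (homc d (a * g)).
Proof.
move=> ge [r re gr].
rewrite {1}(pihomog_partitionE (leqnn (msize a))) mulr_suml raddf_sum /=.
apply: drops_sum => k; set b := homc k a.
have bk : b \is k.-homog by apply: pihomogP.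
have bg : b * g \is (k + e).-homog by apply: dhomogM.
have [kd|kd] := eqVneq (k + e)%N d; last first.
  rewrite (pihomog_ne0 kd) //; exact: drops0.
rewrite pihomog_dE -?kd //; exists (b * r).
  by apply: msizeM_le_add => //; apply: dhomog_msize_le.
by rewrite -mulrBr; apply: idealMl.
Qed.

Lemma ideal_homog_mul I d e a g : g \is e.-homog -> g \in I ->
  homc d (a * g) \in I.
Proof.
move=> ge gI.
rewrite (pihomog_partitionE (leqnn (msize a))) mulr_suml raddf_sum /=.
elim/big_rec: _ => [|k h _ hI]; first exact: ideal0.
apply: idealD => //; set b := homc k a.
have bg : b * g \is (k + e).-homog by apply: dhomogM => //; apply: pihomogP.
have [kd|kd] := eqVneq (k + e)%N d; last first.
  rewrite (pihomog_ne0 kd) //; exact: ideal0.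
by rewrite pihomog_dE -?kd //; apply: idealMl.
Qed.

(** Each generator is homogeneous, and modulo [V] it is congruent to a
polynomial of smaller degree. *)
Definition graded_gens (G : classical_sets.set P) V : Prop :=
  forall g, G g -> exists2 e, g \is e.-homog & drops V e g.

Lemma gen_ideal_drops G V d h : graded_gens G V -> h \in gen_ideal G ->
  drops V d (homc d h).
Proof.
move=> GV; move: h; apply: gen_ideal_ind => [|a g h Gg IHh].
  by rewrite pihomog0; apply: drops0.
have [e ge gV] := GV g Gg.
by rewrite pihomogD; apply: dropsD => //; apply: drops_homog_mul ge gV.
Qed.

Lemma gen_ideal_pihomog G V d h : graded_gens G V -> h \in gen_ideal G ->
  homc d h \in gen_ideal G.
Proof.
move=> GV; move: h; apply: gen_ideal_ind => [|a g h Gg IHh].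
  by rewrite pihomog0; apply: ideal0.
have [e ge gV] := GV g Gg.
rewrite pihomogD; apply: idealD => //; apply: ideal_homog_mul ge _.
exact: gen_ideal_gen.
Qed.

(** If [g] is nonzero, it is the leading form of [g - r], which lies in [V]. *)
Lemma drops_gr V e g : g \is e.-homog -> drops V e g -> g \in gr_ideal V.
Proof.
move=> ge [r re grV]; have [->|g0] := eqVneq g 0; first exact: ideal0.
have topg : homc e (g - r) = g by rewrite pihomogB pihomog_dE // pihomog_gt // subr0.
have gr_ge : (e < msize (g - r))%N.
  by rewrite ltnNge; apply: contra_neqN g0 => /pihomog_gt; rewrite topg.
have gr_le : (msize (g - r) <= e.+1)%N.
  apply: msizeD_le_max; first exact: dhomog_msize_le.
  by rewrite mmeasureN ltnW.
apply: gen_ideal_gen; exists (g - r).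
  split=> //; apply: contraTneq gr_ge => ->; by rewrite msize0.
have sz : msize (g - r) = e.+1 by apply/eqP; rewrite eqn_leq gr_le gr_ge.
by rewrite /top_comp sz topg.
Qed.

Lemma gen_ideal_sub_gr G V h : graded_gens G V -> h \in gen_ideal G ->
  h \in gr_ideal V.
Proof.
move=> GV; apply: gen_ideal_sub => g /GV[e ge gV]; exact: drops_gr gV.
Qed.

Lemma pihomog_supp (B : seq 'X_{1..n}) d f :
  {subset msupp f <= B} -> {subset msupp (homc d f) <= B}.
Proof.
move=> fB m; rewrite mcoeff_msupp pihomogE raddf_sum /= => sum_n0.
apply: fB; apply: contraNT sum_n0 => mf; apply/eqP.
rewrite big_seq_cond big1 // => m' /andP[m'f _].
rewrite mcoeffZ mcoeffX; case: eqP => [mm'|_]; last by rewrite mulr0.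
by rewrite -mm' m'f in mf.
Qed.

Section Basis.
Variables (G : classical_sets.set P) (V : ideal P) (B : seq 'X_{1..n}).
Hypothesis GV : graded_gens G V.
Hypothesis G_span : forall f, in_span B (gen_ideal G) f.

Lemma span_pihomog d f : exists2 q, {subset msupp q <= B} &
  q \is d.-homog /\ homc d f - q \in gen_ideal G.
Proof.
have [q qB fqI] := G_span f; exists (homc d q); first exact: pihomog_supp.
split; first exact: pihomogP.
rewrite -pihomogB; exact: (gen_ideal_pihomog d GV fqI).
Qed.

(** Spanning monomials modulo [gen_ideal G] also span modulo [V], without
raising the degree. *)
Lemma span_mod_lower d f : (msize f <= d)%N -> exists2 q,
  {subset msupp q <= B} & (msize q <= d)%N /\ f - q \in V.
Proof.
elim: d f => [|d IHd] f fd.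
  exists 0; first by move=> m; rewrite msupp0.
  rewrite msize0 subr0; split=> //.
  move: fd; rewrite leqn0 mmeasure_poly_eq0 => /eqP ->; exact: ideal0.
have [q qB [qd fqI]] := span_pihomog d f.
have := gen_ideal_drops d GV fqI.
rewrite pihomogB pihomog_id (pihomog_dE qd) => -[r rd rV].
have [|t tB [td fV]] := IHd (f - homc d f + r).
  by apply: msizeD_le_max => //; apply: msize_sub_pihomog.
exists (q + t) => [m /msuppD_le|].
  by rewrite mem_cat => /orP[/qB|/tB].
split; first by apply: msizeD_le_max; [exact: dhomog_msize_le|exact: ltnW].
rewrite (_ : f - _ = (homc d f - q - r) + (f - homc d f + r - t)).
  exact: idealD.
ring.
Qed.

Hypothesis B_indep : forall q, {subset msupp q <= B} -> q \in V -> q = 0.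

Lemma gr_sub_gen_ideal h : h \in gr_ideal V -> h \in gen_ideal G.
Proof.
apply: gen_ideal_sub => _ [f [fV f0] <-]; rewrite /top_comp.
set d := (msize f).-1.
have fd : (msize f <= d.+1)%N by rewrite /d; case: (msize f).
have [q qB [qd fqI]] := span_pihomog d f.
have := gen_ideal_drops d GV fqI.
rewrite pihomogB pihomog_id (pihomog_dE qd) => -[r rd rV].
have [|t tB [td tV]] := @span_mod_lower d (f - homc d f + r).
  by apply: msizeD_le_max => //; apply: msize_sub_pihomog.
suff q0 : q = 0 by rewrite q0 subr0 in fqI.
(* [t] replaces modulo [V] everything in [f] that has degree less than [d]. *)
have qt0 : q + t = 0.
  apply: B_indep => [m /msuppD_le|].
    by rewrite mem_cat => /orP[/qB|/tB].
  rewrite (_ : q + t = f - (homc d f - q - r) - (f - homc d f + r - t)).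
    by do 2!apply: idealB => //.
  ring.
have := congr1 (homc d) qt0.
by rewrite pihomogD pihomog0 pihomog_dE // pihomog_gt // addr0.
Qed.

End Basis.

End Homogeneous.

(** * Linear independence on a finite set of points *)

Section Independence.
Local Open Scope ring_scope.
Variable n : nat.
Local Notation P := {mpoly rat[n]}.
Implicit Types (p : n.-tuple rat) (Z : seq (n.-tuple rat)).

(** A product of affine forms separates a point from finitely many others. *)
Lemma interpolation p Z : p \notin Z -> exists2 f : P,
  f.@[tnth p] = 1 & forall p', p' \in Z -> f.@[tnth p'] = 0.
Proof.
elim: Z => [|p' Z IHZ]; first by exists 1; rewrite ?meval1.
rewrite inE negb_or => /andP[pp' /IHZ[f fp fZ]].
have [j pj] : exists j, tnth p j - tnth p' j != 0.
  apply/existsP; apply: contraNT pp'; rewrite negb_exists => /forallP pj.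
  by apply/eqP/eq_from_tnth => j; apply/eqP; rewrite -subr_eq0 -[_ == _]negbK pj.
exists (f * ((tnth p j - tnth p' j)^-1 *: ('X_j - (tnth p' j)%:MP))).
  by rewrite mevalM fp mevalZ mevalB mevalXU mevalC mulVf ?mulr1.
move=> p''; rewrite mevalM inE => /orP[/eqP ->|/fZ ->]; last by rewrite mul0r.
by rewrite mevalZ mevalB mevalXU mevalC subrr !mulr0.
Qed.

Lemma mpoly_supp_sum (B : seq 'X_{1..n}) (q : P) : uniq B ->
  {subset msupp q <= B} -> q = \sum_(b < size B) q@_(tnth (in_tuple B) b) *:
    'X_[tnth (in_tuple B) b].
Proof.
move=> uB qB; rewrite -(big_tnth _ _ B xpredT (fun m => q@_m *: 'X_[m])).
apply/mpolyP => m; rewrite raddf_sum /=.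
have [mB|mB] := boolP (m \in B).
  rewrite (bigD1_seq m) //= mcoeffZ mcoeffX eqxx mulr1 big1 ?addr0 // => m' m'm.
  by rewrite mcoeffZ mcoeffX (negPf m'm) mulr0.
rewrite memN_msupp_eq0 ?big_seq ?big1 // => [m' m'B|]; last exact: contra (qB m) mB.
rewrite mcoeffZ mcoeffX; case: eqP => [mm'|_]; last by rewrite mulr0.
by rewrite -mm' m'B in mB.
Qed.

(** Monomials that span the functions on [Z], and are at most as many as the
points of [Z], are linearly independent on [Z]. *)
Lemma indep_of_span (B : seq 'X_{1..n}) Z (q : P) :
  uniq Z -> (size B <= size Z)%N ->
  (forall f : P, exists2 t : P, {subset msupp t <= B} &
     forall p, p \in Z -> f.@[tnth p] = t.@[tnth p]) ->
  {subset msupp q <= B} -> (forall p, p \in Z -> q.@[tnth p] = 0) -> q = 0.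
Proof.
move=> uZ; set B' := undup B => BZ span qB qZ.
have subB (t : P) : {subset msupp t <= B} -> {subset msupp t <= B'}.
  by move=> tB m /tB; rewrite mem_undup.
have uB : uniq B' by apply: undup_uniq.
pose z i := tnth (in_tuple Z) i; pose b i := tnth (in_tuple B') i.
have zZ i : z i \in Z by apply: mem_tnth.
pose A : 'M[rat]_(size Z, size B') := \matrix_(i, j) ('X_[b j] : P).@[tnth (z i)].
have AE (t : P) i : {subset msupp t <= B} ->
    \sum_j A i j * t@_(b j) = t.@[tnth (z i)].
  move=> /subB tB; rewrite [in RHS](mpoly_supp_sum uB tB) raddf_sum /=.
  by apply: eq_bigr => j _; rewrite mevalZ mxE mulrC.
(* The interpolation polynomials provide a right inverse of the evaluation
   matrix [A], which has no more columns than rows; so [A] is invertible. *)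
have dual i : exists t : P, forall i', \sum_j A i' j * t@_(b j) = (i' == i)%:R.
  have [|f fi fZ] := @interpolation (z i) (rem (z i) Z).
    by rewrite mem_rem_uniqF.
  have [t tB tZ] := span f; exists t => i'; rewrite AE // -tZ //.
  have [->//|i'i] := eqVneq i' i; apply: fZ.
  by rewrite mem_rem_uniq // inE zZ andbT /z !(tnth_nth (z i)) nth_uniq ?ltn_ord.
have [T TE] := choice dual.
have AT : A *m (\matrix_(j, i) (T i)@_(b j)) = 1%:M.
  apply/matrixP => i' i; rewrite mxE [RHS]mxE -(TE i i').
  by apply: eq_bigr => j _; rewrite [X in _ * X]mxE.
have /row_fullP[D DA] : row_full A.
  rewrite -col_leq_rank; apply: leq_trans (leq_trans (size_undup B) BZ) _.
  by have := mxrankM_maxl A (\matrix_(j, i) (T i)@_(b j)); rewrite AT mxrank1.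
rewrite (mpoly_supp_sum uB (subB _ qB)) big1 // => j _.
suff -> : q@_(b j) = 0 by rewrite scale0r.
have : D *m (A *m \col_j' q@_(b j')) = 0.
  rewrite (_ : A *m _ = 0) ?mulmx0 //; apply/matrixP => i k.
  rewrite mxE [RHS]mxE -[RHS](qZ _ (zZ i)).
  by rewrite -[RHS]AE //; apply: eq_bigr => j' _; rewrite [X in _ * X]mxE.
by rewrite mulmxA DA mul1mx => /matrixP/(_ j ord0); rewrite !mxE.
Qed.

End Independence.

(** * The generators are leading forms *)

Section Generators.
Local Open Scope ring_scope.
Variables (n s : nat) (lam : seq nat) (alpha : 'I_s -> rat).
Local Notation P := {mpoly rat[n]}.
Hypothesis alpha_inj : injective alpha.
Local Notation X := (@X_points n lam s alpha).
Local Notation mu := (fun r : 'I_s => nth 0%N lam r).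
Local Notation V := (vanishing_ideal X).
Implicit Types (S A : {set 'I_n}).

Lemma meval_prodX (v : 'I_n -> rat) A :
  (\prod_(i in A) 'X_i : P).@[v] = \prod_(i in A) v i.
Proof. by rewrite rmorph_prod; apply: eq_bigr => i _; apply: mevalXU. Qed.

Lemma prodX_homog A : (\prod_(i in A) 'X_i : P) \is #|A|.-homog.
Proof.
have -> : \prod_(i in A) 'X_i = 'X_[mesym1 A] :> P.
  rewrite mpolyXE_id big_mkcond /=; apply: eq_bigr => i _.
  by rewrite mnmE; case: (i \in A).
by rewrite dhomogX /= mdeg_mesym1.
Qed.

Lemma elem_sym_homog S d : (elem_sym S d : P) \is d.-homog.
Proof.
apply: rpred_sum => A /andP[_ /eqP <-]; exact: prodX_homog.
Qed.

Lemma var_exp_drops i : drops V s ('X_i ^+ s : P).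
Proof.
pose F : {poly rat} := \prod_r ('X - (alpha r)%:P).
have sF : size F = s.+1 by rewrite /F -big_enum /= size_prod_XsubC size_enum_ord.
exists (- \sum_(k < s) F`_k *: 'X_i ^+ k).
  rewrite mmeasureN; apply: leq_trans (mmeasure_sum _ _ _ _) _.
  apply/bigmax_leqP => k _; apply: leq_trans (msizeZ_le _ _) _.
  by rewrite mpolyXn msizeX mdegMn mdeg1 mul1n.
apply/asboolP => p [p_alpha _].
have [r pr] := p_alpha i.
have : F.[tnth p i] = 0.
  by rewrite horner_prod (bigD1 r) //= hornerXsubC pr subrr mul0r.
rewrite horner_coef sF big_ord_recr /=.
have -> : F`_s = 1.
  have /monicP : F \is monic by apply: monic_prod => r' _; apply: monicXsubC.
  by rewrite lead_coefE sF.
rewrite mul1r opprK mevalD raddf_sum /= addrC rmorphXn /= mevalXU => F0; rewrite -[RHS]F0.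
by congr (_ + _); apply: eq_bigr => k _; rewrite mevalZ rmorphXn /= mevalXU.
Qed.

(** On a point of [X], the value [alpha r] occurs at least [nth 0 lam r] times,
and at most [n - #|S|] of these occurrences are outside [S]. *)
Lemma vieta_dvd S p : X p ->
  \prod_r ('X + (alpha r)%:P) ^+ (mu r - (n - #|S|)) %|
  \prod_(i in S) ('X + (tnth p i)%:P).
Proof.
move=> [p_alpha p_mu].
have [c cE] := choice p_alpha.
rewrite (partition_big c xpredT) //=.
elim/big_ind2: _ => // [*|r _]; first exact: dvdp_mul.
have -> : \prod_(i in S | c i == r) ('X + (tnth p i)%:P) =
          ('X + (alpha r)%:P) ^+ #|[set i in S | c i == r]|.
  rewrite -prodr_const; apply: eq_big => i; first by rewrite inE.
  by move=> /andP[_ /eqP cr]; rewrite cE cr.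
apply: dvdp_exp2l.
have le_mu : (mu r <= #|[set i | c i == r]|)%N.
  have := p_mu r; rewrite -(map_tnth_enum p) count_map -sum1_card -sum1_count.
  rewrite big_enum_cond /=; move/leq_trans; apply; apply: eq_leq.
  by apply: eq_bigl => i; rewrite inE /= cE (inj_eq alpha_inj).
have : (#|[set i | c i == r]| <= #|[set i in S | c i == r]| + #|~: S|)%N.
  rewrite -(cardsID S [set i | c i == r]) leq_add //; apply/subset_leq_card/subsetP => i.
    by rewrite !inE andbC.
  by rewrite !inE => /andP[].
have := cardsC S; rewrite card_ord; move: le_mu => /=; lia.
Qed.

Lemma elem_sym_drops S d : (#|S| < d + \sum_(r < s) (mu r - (n - #|S|)))%N ->
  drops V d (elem_sym S d : P).
Proof.
set e := (\sum_(r < s) _)%N => Sd.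
have [dS|Sd'] := leqP d #|S|; last by rewrite elem_sym_gt //; apply: drops0.
pose F : {poly rat} := \prod_(r < s) ('X + (alpha r)%:P) ^+ (mu r - (n - #|S|)).
have sF : size F = e.+1.
  rewrite size_prod => [|r _]; last first.
    by rewrite expf_neq0 // -size_poly_eq0 size_XaddC.
  rewrite (eq_bigr (fun r : 'I_s => (mu r - (n - #|S|)) + 1)%N) => [|r _].
    rewrite big_split /= sum1_card -/e subSn ?leq_addl //.
    by rewrite addnK.
  by rewrite -[alpha r]opprK polyCN size_exp_XsubC addn1.
(* The coefficient, in degree [#|S| - d], of the remainder modulo [F] of the
   terms coming from subsets of size [a]. *)
pose c a := ('X^(#|S| - a) %% F)`_(#|S| - d).
have c_small a : (#|S| - a < e)%N -> (a <= #|S|)%N -> c a = (a == d)%:R.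
  move=> aS leaS; rewrite /c modp_small ?size_polyXn ?sF // coefXn.
  by congr (_%:R); lia.
(* The power of ['X] coming from [A] is changed by the reduction only if [A] is
   low; the low subsets have fewer than [d] elements. *)
pose low A := (#|A| + e <= #|S|)%N.
exists (- \sum_(A : {set 'I_n} | (A \subset S) && low A)
           c #|A| *: \prod_(i in A) 'X_i).
  rewrite mmeasureN; apply: leq_trans (mmeasure_sum _ _ _ _) _.
  apply/bigmax_leqP => A /andP[_ lowA]; apply: leq_trans (msizeZ_le _ _) _.
  apply: leq_trans (dhomog_msize_le (prodX_homog A)) _.
  by rewrite /low in lowA; lia.
apply/asboolP => p Xp.
have := modp_eq0 (vieta_dvd S Xp); rewrite -/F.
under eq_bigr do rewrite addrC.
rewrite prod_add_subsets => /(congr1 (fun f : {poly rat} => f`_(#|S| - d))).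
rewrite coef0 => EF.
have {}EF : \sum_(A : {set 'I_n} | A \subset S)
    c #|A| * \prod_(i in A) tnth p i = 0.
  rewrite -[RHS]EF (big_morph (fun f => f %% F) (modpD F) (mod0p F)) coef_sum.
  apply: eq_bigr => A _.
  by rewrite -rmorph_prod mul_polyC modpZl coefZ mulrC.
rewrite opprK mevalD !raddf_sum /= -[RHS]EF.
rewrite big_mkcondr [X in _ + X]big_mkcondr -big_split /=.
apply: eq_bigr => A AS; rewrite mevalZ meval_prodX.
have leAS := subset_leq_card AS.
rewrite /low; case: leqP => [lowA|highA].
  rewrite ifN ?add0r //.
  by apply: contraTneq lowA => ->; rewrite -ltnNge.
rewrite c_small ?addr0 //; last by rewrite ltn_subLR.
by case: eqP => _; rewrite ?mul1r ?mul0r.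
Qed.


End Generators.

(** * The ideals attached to a partition *)

Section Presentation.
Local Open Scope ring_scope.
Variables (n s : nat) (lam : seq nat).
Hypothesis lam_len : (size lam <= s)%N.
Hypothesis lam_sum : (sumn lam <= n)%N.
Local Notation P := {mpoly rat[n]}.
Local Notation mu := (fun r : 'I_s => nth 0%N lam r).

Lemma sum_rows (F : nat -> nat) : F 0%N = 0%N ->
  (\sum_(r < s) F (nth 0 lam r) = \sum_(a <- lam) F a)%N.
Proof.
move=> F0; rewrite (big_nth 0%N) big_mkord.
rewrite (big_ord_widen s (fun r => F (nth 0 lam r))%N lam_len).
rewrite [RHS]big_mkcond; apply: eq_bigr => r _.
by case: ltnP => // lam_r; rewrite nth_default.
Qed.

(** A row of length [a] meets [a - (n - m)] of the columns [n - m + 1, ..., n]. *)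
Lemma sum_columns a m : (a <= n)%N -> (m <= n)%N ->
  (\sum_(i < m) (n - i <= a) = a - (n - m))%N.
Proof.
move=> an; elim: m => [|m IHm] mn; first by rewrite big_ord0; lia.
rewrite big_ord_recr /= IHm; last exact: ltnW.
by case: leqP => /=; lia.
Qed.

Lemma p_stat_excess m : (m <= n)%N ->
  p_stat n m lam = excess mu (n - m).
Proof.
move=> mn; rewrite /excess (sum_rows (F := fun a => (a - (n - m))%N)) //.
have lam_n a : a \in lam -> (a <= n)%N.
  move=> a_lam; apply: leq_trans lam_sum; rewrite sumnE (big_rem a) //=; lia.
transitivity (\sum_(i < m) \sum_(a <- lam) (n - i <= a))%N.
  apply: eq_bigr => i _; rewrite /conj_part -sum1_count big_mkcond /=.
  by apply: eq_bigr => a _; case: ifP.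
by rewrite exchange_big; apply: eq_big_seq => a /lam_n an; apply: sum_columns.
Qed.

(** Because of this bound, no [elem_sym S 0] is among the generators for the
whole set of variables. *)
Lemma excess_le_sub m : (m <= n)%N -> (excess mu (n - m) <= m)%N.
Proof.
move=> mn.
have sum_mu : (\sum_r mu r <= n)%N.
  by rewrite (sum_rows (F := id)) // -sumnE.
have [/forallP small|] := boolP [forall r, mu r <= n - m]%N.
  by rewrite /excess big1 // => r _; apply/eqP; apply: small.
rewrite negb_forall => /existsP[r]; rewrite -ltnNge => big_r.
rewrite /excess (bigD1 r) //=; rewrite (bigD1 r) //= in sum_mu.
have : (\sum_(r' < s | r' != r) (mu r' - (n - m)) <= \sum_(r' < s | r' != r) mu r')%N.
  by apply: leq_sum => r' _; apply: leq_subr.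
move=> rest_le; apply: leq_trans (leq_add (leqnn _) rest_le) _.
by rewrite (addnBAC _ (ltnW big_r)) leq_subLR subnK.
Qed.

(** The two families of generators of [I_ideal] together. *)
Definition I_gens : classical_sets.set P := fun f =>
  (exists i : 'I_n, f = 'X_i ^+ s) \/
  (exists (S : {set 'I_n}) d,
     [/\ (1 <= d)%N, (#|S| < d + p_stat n #|S| lam)%N & f = elem_sym S d]).

Lemma I_idealE : I_ideal n lam s = gen_ideal I_gens.
Proof.
apply: eq_ideal => f; apply/idP/idP.
  move=> /asboolP[g [h [gI hI ->]]]; apply: idealD.
    by apply: gen_ideal_sub gI => g' Gg; apply: gen_ideal_gen; left.
  by apply: gen_ideal_sub hI => g' Gg; apply: gen_ideal_gen; right.
by apply: gen_ideal_sub => g [Gg|Gg]; [apply: add_ideal_l|apply: add_ideal_r];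
  apply: gen_ideal_gen.
Qed.

Lemma rel_ideal_sub_gens (h : P) :
  h \in rel_ideal [set: 'I_n] mu -> h \in gen_ideal I_gens.
Proof.
apply: gen_ideal_sub => _ [[i ->]|[i iT ->]|[S [d [_ Sd ->]]]].
- by apply: gen_ideal_gen; left; exists i.
- by rewrite inE in iT.
have Sn : (#|S| <= n)%N by have := max_card S; rewrite card_ord.
rewrite cardsT card_ord in Sd.
apply: gen_ideal_gen; right; exists S, d; split=> //.
  by move: Sd; case: d => // ; rewrite ltnNge add0n excess_le_sub.
by rewrite p_stat_excess.
Qed.

Lemma graded_I_gens (alpha : 'I_s -> rat) : injective alpha ->
  graded_gens I_gens (vanishing_ideal (X_points n lam alpha)).
Proof.
move=> alpha_inj _ [[i ->]|[S [d [_ Sd ->]]]].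
  exists s; last exact: var_exp_drops.
  by rewrite mpolyXn dhomogX /= mdegMn mdeg1 mul1n.
exists d; first exact: elem_sym_homog.
apply: elem_sym_drops => //; rewrite p_stat_excess // in Sd.
by have := max_card S; rewrite card_ord.
Qed.

End Presentation.

(** Distinct words give distinct points, as [alpha] is injective. *)
Lemma words_points n s (lam : seq nat) (alpha : 'I_s -> rat)
    (W : seq (seq 'I_s)) : injective alpha -> uniq W ->
  (forall w, w \in W -> size w = n /\
     forall r : 'I_s, (nth 0 lam r <= count_mem r w)) ->
  exists Z : seq (n.-tuple rat), [/\ uniq Z, size Z = size W
    & forall p, p \in Z -> X_points n lam alpha p].
Proof.
move=> alpha_inj uW gW; have map_inj := inj_map alpha_inj.
exists (pmap insub (map (map alpha) W)); split.
- by apply: pmap_sub_uniq; rewrite map_inj_uniq.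
- rewrite size_pmap_sub count_map -size_filter; congr size.
  by apply/all_filterP/allP => w /gW[sw _]; rewrite /= size_map sw.
move=> p; rewrite mem_pmap_sub => /mapP[w /gW[_ cw] pw]; split=> [j|r].
  have : tnth p j \in val p by apply: mem_tnth.
  by rewrite pw => /mapP[r _ ->]; exists r.
rewrite pw count_map; apply: leq_trans (cw r) _; apply: eq_leq.
by apply: eq_count => r'; rewrite /= (inj_eq alpha_inj).
Qed.

Lemma I_ideal_eq_gr n s (lam : seq nat) (alpha : 'I_s -> rat) :
  (size lam <= s) -> (sumn lam <= n) -> injective alpha ->
  I_ideal n lam s = gr_ideal (vanishing_ideal (X_points n lam alpha)).
Proof.
move=> lam_len lam_sum alpha_inj; rewrite I_idealE.
have GV := graded_I_gens lam_len lam_sum alpha_inj.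
have [B [W [uW gW BW spanB]]] :=
  rel_ideal_span [set: 'I_n] (fun r : 'I_s => nth 0 lam r).
have {}gW w : w \in W -> size w = n /\
    forall r : 'I_s, (nth 0 lam r <= count_mem r w).
  by move=> /gW; rewrite cardsT card_ord.
have [Z [uZ sZ ZX]] := words_points alpha_inj uW gW.
have spanI f : in_span B (gen_ideal (I_gens s lam)) f.
  by apply: in_span_sub (spanB f) => h; apply: rel_ideal_sub_gens.
apply: eq_ideal => f; apply/idP/idP; first exact: gen_ideal_sub_gr.
apply: (gr_sub_gen_ideal GV spanI) => q qB /asboolP qV.
apply: (indep_of_span uZ _ _ qB) => [|g|p /ZX]; rewrite ?sZ //; last exact: qV.
have [t tB [_ /asboolP gt]] := span_mod_lower GV spanI (leqnn (msize g)).
exists t => // p /ZX Xp.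
by have /eqP := gt p Xp; rewrite mevalB GRing.subr_eq0 => /eqP.
Qed.

Theorem theorem3p1 (k n s : nat) (lam : seq nat) (alpha : 'I_s -> rat)
    (k_gt0 : (0 < k)%N) (k_le_n : (k <= n)%N) (s_gt0 : (0 < s)%N)
    (lam_part : is_partition k lam) (lam_len : (size lam <= s)%N)
    (alpha_inj : injective alpha) :
  I_ideal n lam s = gr_ideal (vanishing_ideal (X_points n lam alpha))
    :> ideal {mpoly rat[n]}
  /\
  R_ring n lam s = quotient (gr_ideal (vanishing_ideal (X_points n lam alpha)))
    :> comPzRingType.
Proof.
have [_ _ sum_lam] := lam_part.
have eI : I_ideal n lam s = gr_ideal (vanishing_ideal (X_points n lam alpha)).
  by apply: I_ideal_eq_gr => //; rewrite sum_lam.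
by split=> //; rewrite /R_ring eI.
Qed.
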